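(* Let $\mathscr{C}$ be an additive category, and $\eta \colon 1_{\mathscr{C}} \to 1_{\mathscr{C}}$ a natural transformation. Suppose that $\mathscr{C} = \operatorname{add} M$ for some object $M \in \mathscr{C}$, and that $\eta_M$ is a regular element of $\operatorname{Hom}_{\mathscr{C}}(M,M)$. Then the functor $\operatorname{Hom}_{\mathscr{C}}(M,-) \otimes_{\Gamma_M} \Gamma_M/(\eta_M)$ induces a fully faithful triangle functor $$(\mathbf{HFact}_2(\mathscr{C},1_{\mathscr{C}},\eta),\Sigma,\Delta) \to \mathbf{K_{tac}}\,\mathscr{P}(\Gamma_M/(\eta_M)),$$ where $\Gamma_M = \operatorname{Hom}_{\mathscr{C}}(M,M)$, and $\mathscr{P}(\Gamma_M/(\eta_M))$ denotes the category of finitely generated projective right $\Gamma_M/(\eta_M)$-modules.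
   Context: $\operatorname{add} M$ is the additive closure of $M$: the full subcategory of all objects $X$ for which there exist a positive integer $n$ and morphisms $X \xrightarrow{i} M^{\oplus n} \xrightarrow{p} X$ with $p \circ i = 1_X$. Since $\eta$ is a natural transformation $1_{\mathscr{C}} \to 1_{\mathscr{C}}$, $\eta_M$ is a central element of $\Gamma_M$; regular means not a zero divisor. The category $\mathbf{HFact}_2(\mathscr{C},1_{\mathscr{C}},\eta)$. Objects are diagrams $M_1 \xrightarrow{f_1} M_2 \xrightarrow{f_2} M_1$ in $\mathscr{C}$ with $f_2 \circ f_1 = \eta_{M_1}$ and $f_1 \circ f_2 = \eta_{M_2}$. A morphism of diagrams from $(M_i,f_i)$ to $(N_i,g_i)$ is a pair $\varphi = (\varphi_1,\varphi_2)$, $\varphi_i \colon M_i \to N_i$, with $\varphi_2 \circ f_1 = g_1 \circ \varphi_1$ and $\varphi_1 \circ f_2 = g_2 \circ \varphi_2$. Two such $\varphi,\varphi'$ are homotopic if there are $s_1 \colon M_2 \to N_1$ and $s_2 \colon M_1 \to N_2$ in $\mathscr{C}$ with $\varphi_1 - \varphi_1' = s_1 \circ f_1 + g_2 \circ s_2$ and $\varphi_2 - \varphi_2' = s_2 \circ f_2 + g_1 \circ s_1$. Morphisms in $\mathbf{HFact}_2(\mathscr{C},1_{\mathscr{C}},\eta)$ are the homotopy classes $[\varphi]$. The suspension is $\Sigma(M_1 \xrightarrow{f_1} M_2 \xrightarrow{f_2} M_1) = (M_2 \xrightarrow{-f_2} M_1 \xrightarrow{-f_1} M_2)$, $\Sigma(\varphi_1,\varphi_2)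 = (\varphi_2,\varphi_1)$. The mapping cone $C_\varphi$ is $M_2 \oplus N_1 \to M_1 \oplus N_2 \to M_2 \oplus N_1$ with maps $\left[\begin{smallmatrix} -f_2 & 0 \\ \varphi_2 & g_1 \end{smallmatrix}\right]$ and $\left[\begin{smallmatrix} -f_1 & 0 \\ \varphi_1 & g_2 \end{smallmatrix}\right]$. A standard triangle is $(M_i,f_i) \xrightarrow{[\varphi]} (N_i,g_i) \xrightarrow{[i_\varphi]} C_\varphi \xrightarrow{[\pi_\varphi]} \Sigma(M_i,f_i)$, where $i_\varphi$ and $\pi_\varphi$ have all components $\left[\begin{smallmatrix} 0 \\ 1 \end{smallmatrix}\right]$ and $\left[\begin{smallmatrix} 1 & 0 \end{smallmatrix}\right]$, respectively. $\Delta$ is the collection of all triangles isomorphic to a standard triangle. With this structure the category is triangulated. The category $\mathbf{K_{tac}}\,\mathscr{P}(\Gamma)$. A complex $C$ of right modules over a ring $\Gamma$ is totally acyclic if both $C$ and $\operatorname{Hom}_\Gamma(C,\Gamma)$ are acyclic (exact). $\mathbf{K_{tac}}\,\mathscr{P}(\Gamma)$ is the homotopy category of totally acyclic complexes of finitely generated projective right $\Gamma$-modules, with the usual triangulated structure of the homotopy category of complexes. The functor. It sends an object $X \xrightarrow{f} Y \xrightarrow{g} X$ to the $2$-periodic complex $\cdots \to \overline{e}(X) \xrightarrow{\overline{f_*}} \overline{e}(Y) \xrightarrow{\overline{g_*}} \overline{e}(X) \xrightarrow{\overline{f_*}} \overline{e}(Y) \to \cdots$, where $\overline{e}(X) = \operatorname{Hom}_{\mathscr{C}}(M,X)/\operatorname{Hom}_{\mathscr{C}}(M,X)\cdot\eta_M$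 (with $\overline{e}(X)$ in even degrees), $f_*(w) = f \circ w$, and overlines denote induced maps; the class of a morphism of factorizations is sent to the class of the induced $2$-periodic chain map. $\operatorname{Hom}_{\mathscr{C}}(M,X)$ is a right $\Gamma_M$-module by precomposition. *)

(* Defs.v *)
From HB Require Import structures.
From mathcomp Require Import all_boot all_order all_algebra.
From mathcomp Require Import boolp.

Set Implicit Arguments.
Unset Strict Implicit.
Unset Printing Implicit Defensive.

Import GRing.Theory.
Local Open Scope ring_scope.
Local Open Scope quotient_scope.

Record subgrp (V : zmodType) := SubGrp {
  sg_mem :> V -> Prop;
  sg0 : sg_mem 0;
  sgB : forall x y, sg_mem x -> sg_mem y -> sg_mem (x - y) }.

Definition sg_pred (V : zmodType) (S : subgrp V) : {pred V} :=
  fun x => `[< S x >].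

Lemma sg_closed (V : zmodType) (S : subgrp V) : zmod_closed (sg_pred S).
Proof.
split; first by apply/asboolP; exact: sg0.
by move=> x y /asboolP Sx /asboolP Sy; apply/asboolP; exact: sgB.
Qed.

HB.instance Definition _ (V : zmodType) (S : subgrp V) :=
  GRing.isZmodClosed.Build V (sg_pred S) (sg_closed S).

Section Quo.
Variables (V : zmodType) (S : subgrp V).

Definition quo : zmodType := Quotient.quot (sg_pred S).
Definition cls (x : V) : quo := \pi x.
Definition rep (u : quo) : V := repr u.

Lemma repK u : cls (rep u) = u. Proof. exact: reprK. Qed.

Lemma cls_eq x y : cls x = cls y <-> S (x - y).
Proof.
split=> [/eqP|Sxy].
  by rewrite /cls -Quotient.idealrBE => /asboolP.
by apply/eqP; rewrite /cls -Quotient.idealrBE; apply/asboolP.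
Qed.

Lemma clsD x y : cls (x + y) = cls x + cls y.
Proof. by rewrite /cls raddfD. Qed.
Lemma cls0 : cls 0 = 0. Proof. by rewrite /cls raddf0. Qed.
Lemma clsN x : cls (- x) = - cls x. Proof. by rewrite /cls raddfN. Qed.
Lemma clsB x y : cls (x - y) = cls x - cls y.
Proof. by rewrite clsD clsN. Qed.
Lemma cls_eq0 x : cls x = 0 <-> S x.
Proof. by rewrite -cls0 cls_eq subr0. Qed.

Lemma rep_cls x : S (rep (cls x) - x).
Proof. by apply/cls_eq; rewrite repK. Qed.
End Quo.

Record preadd := PreAdd {
  ob :> Type;
  hom : ob -> ob -> zmodType;
  idm : forall X, hom X X;
  comp : forall X Y Z, hom Y Z -> hom X Y -> hom X Z;
  compA : forall X Y Z W (h : hom Z W) (g : hom Y Z) (f : hom X Y),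
    comp h (comp g f) = comp (comp h g) f;
  comp1m : forall X Y (f : hom X Y), comp (idm Y) f = f;
  compm1 : forall X Y (f : hom X Y), comp f (idm X) = f;
  compDl : forall X Y Z (g g' : hom Y Z) (f : hom X Y),
    comp (g + g') f = comp g f + comp g' f;
  compDr : forall X Y Z (g : hom Y Z) (f f' : hom X Y),
    comp g (f + f') = comp g f + comp g f' }.

Arguments hom {p} X Y : rename.
Arguments idm {p} X : rename.
Arguments comp {p X Y Z} g f : rename.

Notation "g ∘ f" := (comp g f) (at level 40, left associativity) : ring_scope.

Section PreAddTheory.
Variable C : preadd.

Lemma comp0m (X Y Z : C) (f : hom X Y) : (0 : hom Y Z) ∘ f = 0.
Proof. by apply: (addrI (0 ∘ f)); rewrite -compDl !addr0. Qed.
Lemma compm0 (X Y Z : C) (g : hom Y Z) : g ∘ (0 : hom X Y) = 0.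
Proof. by apply: (addrI (g ∘ 0)); rewrite -compDr !addr0. Qed.
Lemma compNl (X Y Z : C) (g : hom Y Z) (f : hom X Y) : (- g) ∘ f = - (g ∘ f).
Proof. by apply: (addrI (g ∘ f)); rewrite -compDl !subrr comp0m. Qed.
Lemma compNr (X Y Z : C) (g : hom Y Z) (f : hom X Y) : g ∘ (- f) = - (g ∘ f).
Proof. by apply: (addrI (g ∘ f)); rewrite -compDr !subrr compm0. Qed.
Lemma compBl (X Y Z : C) (g g' : hom Y Z) (f : hom X Y) :
  (g - g') ∘ f = g ∘ f - g' ∘ f.
Proof. by rewrite compDl compNl. Qed.
Lemma compBr (X Y Z : C) (g : hom Y Z) (f f' : hom X Y) :
  g ∘ (f - f') = g ∘ f - g ∘ f'.
Proof. by rewrite compDr compNr. Qed.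

Definition is_iso (X Y : C) (f : hom X Y) :=
  exists2 g : hom Y X, g ∘ f = idm X & f ∘ g = idm Y.

End PreAddTheory.

Record addcat := AddCat {
  acat :> preadd;
  zob : acat;
  zobE : idm zob = 0;
  bip : acat -> acat -> acat;
  in1 : forall X Y, hom X (bip X Y);
  in2 : forall X Y, hom Y (bip X Y);
  pr1 : forall X Y, hom (bip X Y) X;
  pr2 : forall X Y, hom (bip X Y) Y;
  pr1in1 : forall X Y, pr1 X Y ∘ in1 X Y = idm X;
  pr2in2 : forall X Y, pr2 X Y ∘ in2 X Y = idm Y;
  pr1in2 : forall X Y, pr1 X Y ∘ in2 X Y = 0;
  pr2in1 : forall X Y, pr2 X Y ∘ in1 X Y = 0;
  bipE : forall X Y, in1 X Y ∘ pr1 X Y + in2 X Y ∘ pr2 X Y = idm (bip X Y) }.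

Arguments bip {a} X Y : rename.
Arguments in1 {a} X Y : rename.
Arguments in2 {a} X Y : rename.
Arguments pr1 {a} X Y : rename.
Arguments pr2 {a} X Y : rename.

Section Matrices.
Variable A : addcat.

(* The morphism X ⊕ Y -> Z ⊕ W with matrix [a b; c d], acting on columns. *)
Definition bmx (X Y Z W : A) (a : hom X Z) (b : hom Y Z)
    (c : hom X W) (d : hom Y W) : hom (bip X Y) (bip Z W) :=
  in1 Z W ∘ (a ∘ pr1 X Y + b ∘ pr2 X Y)
  + in2 Z W ∘ (c ∘ pr1 X Y + d ∘ pr2 X Y).

Section Entries.
Variables (X Y Z W : A).
Variables (a : hom X Z) (b : hom Y Z) (c : hom X W) (d : hom Y W).

Lemma pr1_bmx : pr1 Z W ∘ bmx a b c d = a ∘ pr1 X Y + b ∘ pr2 X Y.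
Proof. by rewrite /bmx compDr !compA pr1in1 pr1in2 comp1m comp0m addr0. Qed.
Lemma pr2_bmx : pr2 Z W ∘ bmx a b c d = c ∘ pr1 X Y + d ∘ pr2 X Y.
Proof. by rewrite /bmx compDr !compA pr2in1 pr2in2 comp1m comp0m add0r. Qed.
Lemma bmx_in1 : bmx a b c d ∘ in1 X Y = in1 Z W ∘ a + in2 Z W ∘ c.
Proof.
rewrite /bmx compDl -!compA !compDl -!compA pr1in1 pr2in1.
by rewrite !compm0 !compm1 !addr0.
Qed.
Lemma bmx_in2 : bmx a b c d ∘ in2 X Y = in1 Z W ∘ b + in2 Z W ∘ d.
Proof.
rewrite /bmx compDl -!compA !compDl -!compA pr1in2 pr2in2.
by rewrite !compm0 !compm1 !add0r.
Qed.
End Entries.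

Lemma to_bip_eq (T X Y : A) (u v : hom T (bip X Y)) :
  pr1 X Y ∘ u = pr1 X Y ∘ v -> pr2 X Y ∘ u = pr2 X Y ∘ v -> u = v.
Proof.
by move=> e1 e2; rewrite -(comp1m u) -(comp1m v) -bipE !compDl -!compA e1 e2.
Qed.

Lemma bmxM (X Y Z W U V : A)
    (a : hom X Z) (b : hom Y Z) (c : hom X W) (d : hom Y W)
    (a' : hom Z U) (b' : hom W U) (c' : hom Z V) (d' : hom W V) :
  bmx a' b' c' d' ∘ bmx a b c d =
  bmx (a' ∘ a + b' ∘ c) (a' ∘ b + b' ∘ d) (c' ∘ a + d' ∘ c) (c' ∘ b + d' ∘ d).
Proof.
apply: to_bip_eq; rewrite compA ?pr1_bmx ?pr2_bmx compDl -!compA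
  pr1_bmx pr2_bmx !compDl !compDr !compA; exact: addrACA.
Qed.

Lemma bmx0 (X Y Z W : A) : bmx (0 : hom X Z) (0 : hom Y Z) (0 : hom X W) 0 = 0.
Proof. by rewrite /bmx !comp0m !addr0 !compm0 addr0. Qed.

Fixpoint bpow (M : A) (n : nat) : A :=
  if n is m.+1 then bip M (bpow M m) else zob A.

Definition in_add (M X : A) :=
  exists (n : nat) (i : hom X (bpow M n)) (p : hom (bpow M n) X),
    (0 < n)%N /\ p ∘ i = idm X.

End Matrices.

Record functor (C D : preadd) := Functor {
  fob :> C -> D;
  fmap : forall X Y, hom X Y -> hom (fob X) (fob Y);
  fmap1 : forall X, fmap (idm X) = idm (fob X);
  fmapM : forall X Y Z (g : hom Y Z) (f : hom X Y),
    fmap (g ∘ f) = fmap g ∘ fmap f;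
  fmapD : forall X Y (f g : hom X Y), fmap (f + g) = fmap f + fmap g }.

Arguments fmap {C D} f {X Y} _ : rename.

Section FunctorTheory.
Variables (C D : preadd) (F : functor C D).
Lemma fmap0 (X Y : C) : fmap F (0 : hom X Y) = 0.
Proof. by apply: (addrI (fmap F 0)); rewrite -fmapD !addr0. Qed.
Lemma fmapN (X Y : C) (f : hom X Y) : fmap F (- f) = - fmap F f.
Proof. by apply: (addrI (fmap F f)); rewrite -fmapD !subrr fmap0. Qed.
Lemma fmapB (X Y : C) (f g : hom X Y) : fmap F (f - g) = fmap F f - fmap F g.
Proof. by rewrite fmapD fmapN. Qed.
End FunctorTheory.

Definition fully_faithful (C D : preadd) (F : functor C D) :=
  forall X Y : C, bijective (fun f : hom X Y => fmap F f).

Record endonat (C : preadd) := EndoNat {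
  nt :> forall X : C, hom X X;
  ntE : forall (X Y : C) (f : hom X Y), nt Y ∘ f = f ∘ nt X }.

Record ideal (C : preadd) := Ideal {
  imem : forall X Y : C, subgrp (hom X Y);
  imemL : forall (X Y Z : C) (g : hom Y Z) (f : hom X Y),
    imem X Y f -> imem X Z (g ∘ f);
  imemR : forall (X Y Z : C) (g : hom Y Z) (f : hom X Y),
    imem Y Z g -> imem X Z (g ∘ f) }.

Section QuotCat.
Variables (C : preadd) (I : ideal C).

Definition qhom (X Y : C) : zmodType := quo (imem I X Y).
Definition qcls (X Y : C) (f : hom X Y) : qhom X Y := cls _ f.
Definition qcomp (X Y Z : C) (g : qhom Y Z) (f : qhom X Y) : qhom X Z :=
  qcls (rep g ∘ rep f).

Lemma qcompE (X Y Z : C) (g : hom Y Z) (f : hom X Y) :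
  qcomp (qcls g) (qcls f) = qcls (g ∘ f).
Proof.
rewrite /qcomp /qcls; set f' := rep _; set g' := rep _.
have -> : cls (imem I X Z) (f' ∘ g') = cls _ (f' ∘ f).
  by apply/cls_eq; rewrite -compBr; apply: imemL; exact: rep_cls.
by apply/cls_eq; rewrite -compBl; apply: imemR; exact: rep_cls.
Qed.

Lemma qcompA (X Y Z W : C) (h : qhom Z W) (g : qhom Y Z) (f : qhom X Y) :
  qcomp h (qcomp g f) = qcomp (qcomp h g) f.
Proof.
by rewrite -(repK h) -(repK g) -(repK f) -!/(qcls _) !qcompE compA.
Qed.
Lemma qcomp1m (X Y : C) (f : qhom X Y) : qcomp (qcls (idm Y)) f = f.
Proof. by rewrite -(repK f) -!/(qcls _) !qcompE comp1m. Qed.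
Lemma qcompm1 (X Y : C) (f : qhom X Y) : qcomp f (qcls (idm X)) = f.
Proof. by rewrite -(repK f) -!/(qcls _) !qcompE compm1. Qed.
Lemma qcompDl (X Y Z : C) (g g' : qhom Y Z) (f : qhom X Y) :
  qcomp (g + g') f = qcomp g f + qcomp g' f.
Proof.
rewrite -(repK g) -(repK g') -(repK f) -clsD -!/(qcls _) !qcompE.
by rewrite compDl /qcls clsD.
Qed.
Lemma qcompDr (X Y Z : C) (g : qhom Y Z) (f f' : qhom X Y) :
  qcomp g (f + f') = qcomp g f + qcomp g f'.
Proof.
rewrite -(repK g) -(repK f') -(repK f) -clsD -!/(qcls _) !qcompE.
by rewrite compDr /qcls clsD.
Qed.

Definition quotcat : preadd :=
  PreAdd qcompA qcomp1m qcompm1 qcompDl qcompDr.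

End QuotCat.

Arguments qcls {C} I {X Y} f.

Section QuotFun.
Variables (C D : preadd) (I : ideal C) (J : ideal D) (F : functor C D).
Hypothesis FIJ : forall (X Y : C) (f : hom X Y),
  imem I X Y f -> imem J (F X) (F Y) (fmap F f).

Definition qfmap (X Y : quotcat I) (f : hom X Y) :
  @hom (quotcat J) (F X) (F Y) := qcls J (fmap F (rep f)).

Lemma qfmapE (X Y : C) (f : hom X Y) :
  qfmap (qcls I f) = qcls J (fmap F f).
Proof.
by apply/cls_eq; rewrite -fmapB; apply: FIJ; exact: rep_cls.
Qed.
Lemma qfmap1 (X : quotcat I) : qfmap (idm X) = idm _.
Proof. by rewrite [LHS]qfmapE fmap1. Qed.
Lemma qfmapM (X Y Z : quotcat I) (g : hom Y Z) (f : hom X Y) :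
  qfmap (g ∘ f) = qfmap g ∘ qfmap f.
Proof.
rewrite -(repK g) -(repK f) -!/(qcls I _) /= qcompE !qfmapE fmapM.
by rewrite qcompE.
Qed.
Lemma qfmapD (X Y : quotcat I) (f g : hom X Y) :
  qfmap (f + g) = qfmap f + qfmap g.
Proof.
rewrite -(repK f) -(repK g) -clsD -!/(qcls I _) !qfmapE fmapD.
by rewrite /qcls clsD.
Qed.

Definition quotfun : functor (quotcat I) (quotcat J) :=
  @Functor (quotcat I) (quotcat J) F qfmap qfmap1 qfmapM qfmapD.

End QuotFun.

Definition fullsub (C : preadd) (P : C -> Prop) : preadd :=
  @PreAdd {X : C | P X} (fun X Y => hom (sval X) (sval Y))
    (fun X => idm (sval X)) (fun X Y Z g f => g ∘ f)
    (fun X Y Z W h g f => compA h g f)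
    (fun X Y f => comp1m f) (fun X Y f => compm1 f)
    (fun X Y Z g g' f => compDl g g' f)
    (fun X Y Z g f f' => compDr g f f').

Definition corestrict (C D : preadd) (P : D -> Prop) (F : functor C D)
    (H : forall X, P (F X)) : functor C (fullsub P) :=
  @Functor C (fullsub P) (fun X => exist P (F X) (H X))
    (fun X Y f => fmap F f) (fun X => fmap1 F X)
    (fun X Y Z g f => fmapM F g f) (fun X Y f g => fmapD F f g).

Definition fullendo (C : preadd) (P : C -> Prop) (F : functor C C)
    (H : forall X, P X -> P (F X)) : functor (fullsub P) (fullsub P) :=
  @Functor (fullsub P) (fullsub P)
    (fun X => exist P (F (sval X)) (H _ (svalP X)))
    (fun X Y f => fmap F f) (fun X => fmap1 F (sval X))
    (fun X Y Z g f => fmapM F g f) (fun X Y f g => fmapD F f g).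

Record triangle (C : preadd) (S : functor C C) := Triangle {
  tX : C; tY : C; tZ : C;
  tf : hom tX tY; tg : hom tY tZ; th : hom tZ (S tX) }.

Arguments Triangle {C S tX tY tZ} tf tg th.

Definition tri_iso (C : preadd) (S : functor C C) (t u : triangle S) :=
  exists (a : hom (tX t) (tX u)) (b : hom (tY t) (tY u)) (c : hom (tZ t) (tZ u)),
    [/\ is_iso a, is_iso b & is_iso c] /\
    [/\ b ∘ tf t = tf u ∘ a, c ∘ tg t = tg u ∘ b
      & fmap S a ∘ th t = th u ∘ c].

(* A category with a suspension and a class of distinguished triangles. Only
   the data is recorded: the axioms of triangulated categories do not enter
   the definition of a triangle functor. *)
Record tricat := TriCat {
  tcat :> preadd;
  susp : functor tcat tcat;
  dist : triangle susp -> Prop }.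

Arguments susp {t} : rename.

Definition triangle_functor (S T : tricat) (F : functor S T) :=
  exists theta : forall X : S, hom (F (susp X)) (susp (F X)),
    [/\ forall X, is_iso (theta X),
        forall (X Y : S) (f : hom X Y),
          theta Y ∘ fmap F (fmap susp f) = fmap susp (fmap F f) ∘ theta X
      & forall t : triangle (@susp S), dist t ->
          dist (@Triangle T susp _ _ _ (fmap F (tf t)) (fmap F (tg t))
                  (theta (tX t) ∘ fmap F (th t)))].

Definition fulltri (T : tricat) (P : T -> Prop)
    (H : forall X, P X -> P (susp X)) : tricat :=
  @TriCat (fullsub P) (fullendo H)
    (fun t => dist (@Triangle T susp _ _ _ (tf t) (tg t) (th t))).

Section Factorizations.
Variables (C : addcat) (eta : endonat C).

Record fact := Fact {
  f_1 : C; f_2 : C;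
  d_1 : hom f_1 f_2;
  d_2 : hom f_2 f_1;
  d_21 : d_2 ∘ d_1 = eta f_1;
  d_12 : d_1 ∘ d_2 = eta f_2 }.

Record fmor (X Y : fact) := FMor {
  m_1 : hom (f_1 X) (f_1 Y);
  m_2 : hom (f_2 X) (f_2 Y);
  m_21 : m_2 ∘ d_1 X = d_1 Y ∘ m_1;
  m_12 : m_1 ∘ d_2 X = d_2 Y ∘ m_2 }.

Lemma fmor_eq X Y (u v : fmor X Y) : m_1 u = m_1 v -> m_2 u = m_2 v -> u = v.
Proof.
case: u v => [u1 u2 u21 u12] [v1 v2 v21 v12] /= e1 e2; subst v1 v2.
by congr FMor; exact: Prop_irrelevance.
Qed.

HB.instance Definition _ X Y := gen_eqMixin (fmor X Y).
HB.instance Definition _ X Y := gen_choiceMixin (fmor X Y).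

Section FMorGroup.
Variables X Y : fact.

Program Definition fmor0 : fmor X Y := @FMor X Y 0 0 _ _.
Next Obligation. by rewrite comp0m compm0. Qed.
Next Obligation. by rewrite comp0m compm0. Qed.

Program Definition fmorN (u : fmor X Y) : fmor X Y :=
  @FMor X Y (- m_1 u) (- m_2 u) _ _.
Next Obligation. by rewrite compNl compNr m_21. Qed.
Next Obligation. by rewrite compNl compNr m_12. Qed.

Program Definition fmorD (u v : fmor X Y) : fmor X Y :=
  @FMor X Y (m_1 u + m_1 v) (m_2 u + m_2 v) _ _.
Next Obligation. by rewrite compDl compDr !m_21. Qed.
Next Obligation. by rewrite compDl compDr !m_12. Qed.

Lemma fmorDA : associative fmorD.
Proof. by move=> u v w; apply: fmor_eq; exact: addrA. Qed.
Lemma fmorDC : commutative fmorD.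
Proof. by move=> u v; apply: fmor_eq; exact: addrC. Qed.
Lemma fmor0D : left_id fmor0 fmorD.
Proof. by move=> u; apply: fmor_eq; exact: add0r. Qed.
Lemma fmorND : left_inverse fmor0 fmorN fmorD.
Proof. by move=> u; apply: fmor_eq; exact: addNr. Qed.

HB.instance Definition _ :=
  GRing.isZmodule.Build (fmor X Y) fmorDA fmorDC fmor0D fmorND.
End FMorGroup.

Program Definition fid (X : fact) : fmor X X :=
  @FMor X X (idm _) (idm _) _ _.
Next Obligation. by rewrite comp1m compm1. Qed.
Next Obligation. by rewrite comp1m compm1. Qed.

Program Definition fcomp (X Y Z : fact) (v : fmor Y Z) (u : fmor X Y) :
    fmor X Z := @FMor X Z (m_1 v ∘ m_1 u) (m_2 v ∘ m_2 u) _ _.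
Next Obligation. by rewrite -compA m_21 !compA m_21. Qed.
Next Obligation. by rewrite -compA m_12 !compA m_12. Qed.

Program Definition factcat : preadd :=
  @PreAdd fact (fun X Y => fmor X Y) fid fcomp _ _ _ _ _.
Next Obligation. by apply: fmor_eq; exact: compA. Qed.
Next Obligation. by apply: fmor_eq; exact: comp1m. Qed.
Next Obligation. by apply: fmor_eq; exact: compm1. Qed.
Next Obligation. by apply: fmor_eq; exact: compDl. Qed.
Next Obligation. by apply: fmor_eq; exact: compDr. Qed.

Definition fnull (X Y : fact) (u : fmor X Y) :=
  exists (s1 : hom (f_2 X) (f_1 Y)) (s2 : hom (f_1 X) (f_2 Y)),
    m_1 u = s1 ∘ d_1 X + d_2 Y ∘ s2 /\ m_2 u = s2 ∘ d_2 X + d_1 Y ∘ s1.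

Program Definition fnull_subgrp (X Y : fact) : subgrp (fmor X Y) :=
  @SubGrp _ (@fnull X Y) _ _.
Next Obligation. by exists 0, 0; rewrite !comp0m !compm0 !addr0. Qed.
Next Obligation.
case: H => s1 [s2 [e1 e2]]; case: H0 => t1 [t2 [e3 e4]].
exists (s1 - t1), (s2 - t2).
by rewrite /= e1 e2 e3 e4 !compBl !compBr !opprD; split; exact: addrACA.
Qed.

Program Definition fhtpy : ideal factcat := @Ideal factcat fnull_subgrp _ _.
Next Obligation.
case: H => s1 [s2 [e1 e2]]; exists (m_1 g ∘ s1), (m_2 g ∘ s2).
by rewrite /= e1 e2 !compDr !compA m_12 m_21.
Qed.
Next Obligation.
case: H => s1 [s2 [e1 e2]]; exists (s1 ∘ m_2 f), (s2 ∘ m_1 f).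
by rewrite /= e1 e2 !compDl -!compA m_12 m_21.
Qed.

Program Definition fshift (X : fact) : fact :=
  @Fact (f_2 X) (f_1 X) (- d_2 X) (- d_1 X) _ _.
Next Obligation. by rewrite compNl compNr opprK d_12. Qed.
Next Obligation. by rewrite compNl compNr opprK d_21. Qed.

Program Definition fshiftm (X Y : fact) (u : fmor X Y) :
    fmor (fshift X) (fshift Y) := @FMor (fshift X) (fshift Y) (m_2 u) (m_1 u) _ _.
Next Obligation. by rewrite compNl compNr m_12. Qed.
Next Obligation. by rewrite compNl compNr m_21. Qed.

Program Definition fshift_fun : functor factcat factcat :=
  @Functor factcat factcat fshift fshiftm _ _ _.
Next Obligation. exact: fmor_eq. Qed.
Next Obligation. exact: fmor_eq. Qed.
Next Obligation. exact: fmor_eq. Qed.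

Lemma fshift_null (X Y : factcat) (u : hom X Y) :
  imem fhtpy X Y u -> imem fhtpy _ _ (fmap fshift_fun u).
Proof.
case=> s1 [s2 [e1 e2]]; exists (- s2), (- s1); rewrite /= e1 e2.
by rewrite !compNl !compNr !opprK.
Qed.

Lemma eta_bip (X Y : C) : bmx (eta X) 0 0 (eta Y) = eta (bip X Y).
Proof.
apply: to_bip_eq; rewrite ?pr1_bmx ?pr2_bmx comp0m ?addr0 ?add0r; exact: ntE.
Qed.

Program Definition fcone (X Y : fact) (u : fmor X Y) : fact :=
  @Fact (bip (f_2 X) (f_1 Y)) (bip (f_1 X) (f_2 Y))
    (bmx (- d_2 X) 0 (m_2 u) (d_1 Y)) (bmx (- d_1 X) 0 (m_1 u) (d_2 Y)) _ _.
Next Obligation.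
rewrite bmxM -eta_bip !comp0m !compm0 !addr0 add0r compNl !compNr opprK.
by rewrite m_12 addNr d_12 d_21.
Qed.
Next Obligation.
rewrite bmxM -eta_bip !comp0m !compm0 !addr0 add0r compNl !compNr opprK.
by rewrite m_21 addNr d_12 d_21.
Qed.

Program Definition fcone_in (X Y : fact) (u : fmor X Y) : fmor Y (fcone u) :=
  @FMor Y (fcone u) (in2 _ _) (in2 _ _) _ _.
Next Obligation. by rewrite bmx_in2 compm0 add0r. Qed.
Next Obligation. by rewrite bmx_in2 compm0 add0r. Qed.

Program Definition fcone_pr (X Y : fact) (u : fmor X Y) :
    fmor (fcone u) (fshift X) := @FMor (fcone u) (fshift X) (pr1 _ _) (pr1 _ _) _ _.
Next Obligation. by rewrite pr1_bmx comp0m addr0. Qed.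
Next Obligation. by rewrite pr1_bmx comp0m addr0. Qed.

Definition HFact_cat : preadd := quotcat fhtpy.
Definition HFact_susp : functor HFact_cat HFact_cat := quotfun fshift_null.

Definition fstd (X Y : fact) (u : fmor X Y) : triangle HFact_susp :=
  @Triangle HFact_cat HFact_susp X Y (fcone u)
    (@qcls factcat fhtpy X Y u)
    (@qcls factcat fhtpy Y (fcone u) (fcone_in u))
    (@qcls factcat fhtpy (fcone u) (fshift X) (fcone_pr u)).

Definition HFact : tricat :=
  @TriCat HFact_cat HFact_susp
    (fun t => exists (X Y : fact) (u : fmor X Y), tri_iso t (fstd u)).

End Factorizations.

Section Complexes.
Variable A : addcat.

Record complex := Complex {
  cob :> int -> A;
  cd : forall n, hom (cob n) (cob (n + 1));
  cdd : forall n, cd (n + 1) ∘ cd n = 0 }.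

Record chmap (X Y : complex) := ChMap {
  cm :> forall n, hom (X n) (Y n);
  cmE : forall n, cm (n + 1) ∘ cd X n = cd Y n ∘ cm n }.

Lemma chmap_eq X Y (u v : chmap X Y) : (forall n, u n = v n) -> u = v.
Proof.
case: u v => [u uE] [v vE] /= e; have e' : u = v by apply/functional_extensionality_dep.
by subst v; congr ChMap; exact: Prop_irrelevance.
Qed.

HB.instance Definition _ X Y := gen_eqMixin (chmap X Y).
HB.instance Definition _ X Y := gen_choiceMixin (chmap X Y).

Section ChMapGroup.
Variables X Y : complex.

Program Definition chmap0 : chmap X Y := @ChMap X Y (fun=> 0) _.
Next Obligation. by rewrite comp0m compm0. Qed.

Program Definition chmapN (u : chmap X Y) : chmap X Y :=
  @ChMap X Y (fun n => - u n) _.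
Next Obligation. by rewrite compNl compNr cmE. Qed.

Program Definition chmapD (u v : chmap X Y) : chmap X Y :=
  @ChMap X Y (fun n => u n + v n) _.
Next Obligation. by rewrite compDl compDr !cmE. Qed.

Lemma chmapDA : associative chmapD.
Proof. by move=> u v w; apply: chmap_eq => n; exact: addrA. Qed.
Lemma chmapDC : commutative chmapD.
Proof. by move=> u v; apply: chmap_eq => n; exact: addrC. Qed.
Lemma chmap0D : left_id chmap0 chmapD.
Proof. by move=> u; apply: chmap_eq => n; exact: add0r. Qed.
Lemma chmapND : left_inverse chmap0 chmapN chmapD.
Proof. by move=> u; apply: chmap_eq => n; exact: addNr. Qed.

HB.instance Definition _ :=
  GRing.isZmodule.Build (chmap X Y) chmapDA chmapDC chmap0D chmapND.
End ChMapGroup.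

Program Definition chid (X : complex) : chmap X X :=
  @ChMap X X (fun=> idm _) _.
Next Obligation. by rewrite comp1m compm1. Qed.

Program Definition chcomp (X Y Z : complex) (v : chmap Y Z) (u : chmap X Y) :
    chmap X Z := @ChMap X Z (fun n => v n ∘ u n) _.
Next Obligation. by rewrite -compA cmE !compA cmE. Qed.

Program Definition chcat : preadd :=
  @PreAdd complex (fun X Y => chmap X Y) chid chcomp _ _ _ _ _.
Next Obligation. by apply: chmap_eq => n; exact: compA. Qed.
Next Obligation. by apply: chmap_eq => n; exact: comp1m. Qed.
Next Obligation. by apply: chmap_eq => n; exact: compm1. Qed.
Next Obligation. by apply: chmap_eq => n; exact: compDl. Qed.
Next Obligation. by apply: chmap_eq => n; exact: compDr. Qed.

(* Every degree is of the form n + 1; s n stands for the component of the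
   homotopy leaving degree n + 1. *)
Definition chnull (X Y : complex) (u : chmap X Y) :=
  exists s : forall n, hom (X (n + 1)) (Y n),
    forall n, u (n + 1) = cd Y n ∘ s n + s (n + 1) ∘ cd X (n + 1).

Program Definition chnull_subgrp (X Y : complex) : subgrp (chmap X Y) :=
  @SubGrp _ (@chnull X Y) _ _.
Next Obligation. by exists (fun=> 0) => n; rewrite comp0m compm0 addr0. Qed.
Next Obligation.
case: H => s es; case: H0 => t et; exists (fun n => s n - t n) => n.
by rewrite /= es et compBl compBr opprD addrACA.
Qed.

Program Definition chhtpy : ideal chcat := @Ideal chcat chnull_subgrp _ _.
Next Obligation.
case: H => s es; exists (fun n => g n ∘ s n) => n.
by rewrite /= es !compDr !compA cmE.
Qed.
Next Obligation.
case: H => s es; exists (fun n => s n ∘ f (n + 1)) => n.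
by rewrite /= es !compDl -!compA cmE.
Qed.

Program Definition shift (X : complex) : complex :=
  @Complex (fun n => X (n + 1)) (fun n => - cd X (n + 1)) _.
Next Obligation. by rewrite compNl compNr opprK cdd. Qed.

Program Definition shiftm (X Y : complex) (u : chmap X Y) :
    chmap (shift X) (shift Y) :=
  @ChMap (shift X) (shift Y) (fun n => u (n + 1)) _.
Next Obligation. by rewrite compNl compNr cmE. Qed.

Program Definition shift_fun : functor chcat chcat :=
  @Functor chcat chcat shift shiftm _ _ _.
Next Obligation. exact: chmap_eq. Qed.
Next Obligation. exact: chmap_eq. Qed.
Next Obligation. exact: chmap_eq. Qed.

Lemma shift_null (X Y : chcat) (u : hom X Y) :
  imem chhtpy X Y u -> imem chhtpy _ _ (fmap shift_fun u).
Proof.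
case=> s es; exists (fun n => - s (n + 1)) => n.
by rewrite /= es !compNl !compNr !opprK.
Qed.

Program Definition cone (X Y : complex) (u : chmap X Y) : complex :=
  @Complex (fun n => bip (X (n + 1)) (Y n))
    (fun n => bmx (- cd X (n + 1)) 0 (u (n + 1)) (cd Y n)) _.
Next Obligation.
rewrite bmxM !comp0m !compm0 !addr0 add0r compNl !compNr opprK.
by rewrite !cdd cmE addNr bmx0.
Qed.

Program Definition cone_in (X Y : complex) (u : chmap X Y) : chmap Y (cone u) :=
  @ChMap Y (cone u) (fun=> in2 _ _) _.
Next Obligation. by rewrite bmx_in2 compm0 add0r. Qed.

Program Definition cone_pr (X Y : complex) (u : chmap X Y) :
    chmap (cone u) (shift X) := @ChMap (cone u) (shift X) (fun=> pr1 _ _) _.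
Next Obligation. by rewrite pr1_bmx comp0m addr0. Qed.

Definition K_cat : preadd := quotcat chhtpy.
Definition K_susp : functor K_cat K_cat := quotfun shift_null.

Definition chstd (X Y : complex) (u : chmap X Y) : triangle K_susp :=
  @Triangle K_cat K_susp X Y (cone u)
    (@qcls chcat chhtpy X Y u)
    (@qcls chcat chhtpy Y (cone u) (cone_in u))
    (@qcls chcat chhtpy (cone u) (shift X) (cone_pr u)).

Definition Khtpy : tricat :=
  @TriCat K_cat K_susp
    (fun t => exists (X Y : complex) (u : chmap X Y), tri_iso t (chstd u)).

End Complexes.

Section Periodic.
Variables (C : addcat) (eta : endonat C) (A : addcat) (G : functor C A).
Hypothesis Geta : forall X : C, fmap G (eta X) = 0.

Definition par (n : int) : bool := odd `|n|%N.

Lemma parS n : par (n + 1) = ~~ par n.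
Proof.
case: n => [n|n]; first by rewrite -PoszD addn1.
have -> : Negz n + 1 = - (n%:Z) by rewrite NegzE -addn1 PoszD opprD addrNK.
by rewrite /par NegzE !abszN /= negbK.
Qed.

Definition per_ob (X : fact eta) (b : bool) : A :=
  if b then G (f_2 X) else G (f_1 X).

(* Only the cases b' = ~~ b matter, since the parities of n and n + 1 differ. *)
Definition per_d (X : fact eta) (b b' : bool) :
    hom (per_ob X b) (per_ob X b') :=
  match b, b' with
  | false, true => fmap G (d_1 X)
  | true, false => fmap G (d_2 X)
  | _, _ => 0
  end.

Definition per_m (X Y : fact eta) (u : fmor X Y) (b : bool) :
    hom (per_ob X b) (per_ob Y b) :=
  if b return hom (per_ob X b) (per_ob Y b)
  then fmap G (m_2 u) else fmap G (m_1 u).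

Program Definition per (X : fact eta) : complex A :=
  @Complex A (fun n => per_ob X (par n)) (fun n => per_d X (par n) (par (n + 1))) _.
Next Obligation.
move: (par n) (par (n + 1)) (par (n + 1 + 1)) => [] [] [];
  by rewrite /= ?comp0m ?compm0 // -fmapM ?d_12 ?d_21.
Qed.

Program Definition per_map (X Y : fact eta) (u : fmor X Y) : chmap (per X) (per Y) :=
  @ChMap A (per X) (per Y) (fun n => per_m u (par n)) _.
Next Obligation.
move: (par n) (par (n + 1)) => [] [];
  by rewrite /= ?comp0m ?compm0 // -!fmapM ?m_12 ?m_21.
Qed.

Program Definition per_fun : functor (factcat eta) (chcat A) :=
  @Functor (factcat eta) (chcat A) per per_map _ _ _.
Next Obligation.
by apply: chmap_eq => n /=; rewrite /per_m; case: (par n); exact: fmap1.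
Qed.
Next Obligation.
by apply: chmap_eq => n /=; rewrite /per_m; case: (par n); exact: fmapM.
Qed.
Next Obligation.
by apply: chmap_eq => n /=; rewrite /per_m; case: (par n); exact: fmapD.
Qed.

Lemma per_null (X Y : factcat eta) (u : hom X Y) :
  imem (fhtpy eta) X Y u -> imem (chhtpy A) _ _ (fmap per_fun u).
Proof.
case=> s1 [s2 [e1 e2]].
pose s b b' : hom (per_ob X b) (per_ob Y b') :=
  match b, b' with
  | false, true => fmap G s2
  | true, false => fmap G s1
  | _, _ => 0
  end.
exists (fun n => s (par (n + 1)) (par n)) => n /=.
rewrite [par (n + 1 + 1)]parS; move: (parS n).
move: (par n) (par (n + 1)) => [] [] //= _.
  by rewrite e1 fmapD !fmapM addrC.
by rewrite e2 fmapD !fmapM addrC.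
Qed.

Definition periodic : functor (HFact eta) (Khtpy A) := quotfun per_null.

End Periodic.

HB.instance Definition _ (S : pzRingType) (U V : lmodType S) :=
  gen_eqMixin {linear U -> V}.
HB.instance Definition _ (S : pzRingType) (U V : lmodType S) :=
  gen_choiceMixin {linear U -> V}.

Lemma lin_eq (S : pzRingType) (U V : lmodType S) (f g : {linear U -> V}) :
  f =1 g -> f = g.
Proof.
case: f g => [f [[fD] [fZ]]] [g [[gD] [gZ]]] /= /funext e; subst g.
by rewrite (Prop_irrelevance fD gD) (Prop_irrelevance fZ gZ).
Qed.

Definition mklin (S : pzRingType) (U V : lmodType S) (f : U -> V)
    (fL : linear f) : {linear U -> V} :=
  HB.pack_for {linear U -> V} f (GRing.isLinear.Build S U V *:%R f fL).

Section LinGroup.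
Variables (S : pzRingType) (U V : lmodType S).

Definition lin0 : {linear U -> V} := \0.
Lemma linN_subproof (f : {linear U -> V}) : linear (fun x => - f x).
Proof. by move=> a x y; rewrite linearP opprD scalerN. Qed.
Definition linN (f : {linear U -> V}) : {linear U -> V} :=
  mklin (linN_subproof f).
Definition linD (f g : {linear U -> V}) : {linear U -> V} := f \+ g.

Lemma linDA : associative linD.
Proof. by move=> f g h; apply: lin_eq => x; exact: addrA. Qed.
Lemma linDC : commutative linD.
Proof. by move=> f g; apply: lin_eq => x; exact: addrC. Qed.
Lemma lin0D : left_id lin0 linD.
Proof. by move=> f; apply: lin_eq => x; exact: add0r. Qed.
Lemma linND : left_inverse lin0 linN linD.
Proof. by move=> f; apply: lin_eq => x; exact: addNr. Qed.

HB.instance Definition _ :=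
  GRing.isZmodule.Build {linear U -> V} linDA linDC lin0D linND.
End LinGroup.

Program Definition lmod_preadd (S : pzRingType) : preadd :=
  @PreAdd (lmodType S) (fun U V => {linear U -> V}) (fun U => idfun)
    (fun U V W g f => g \o f) _ _ _ _ _.
Next Obligation. exact: lin_eq. Qed.
Next Obligation. exact: lin_eq. Qed.
Next Obligation. exact: lin_eq. Qed.
Next Obligation. exact: lin_eq. Qed.
Next Obligation. by apply: lin_eq => x; exact: raddfD. Qed.

Lemma lin_in1 (S : pzRingType) (U V : lmodType S) :
  linear (fun x : U => (x, 0 : V)).
Proof. by move=> a x y; congr pair; rewrite /= scaler0 addr0. Qed.
Lemma lin_in2 (S : pzRingType) (U V : lmodType S) :
  linear (fun y : V => (0 : U, y)).
Proof. by move=> a x y; congr pair; rewrite /= scaler0 addr0. Qed.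

Program Definition lmods (S : pzRingType) : addcat :=
  @AddCat (lmod_preadd S) 'rV[S]_0 _ (fun U V => (U * V)%type)
    (fun U V => mklin (@lin_in1 S U V)) (fun U V => mklin (@lin_in2 S U V))
    (fun U V => fst) (fun U V => snd) _ _ _ _ _.
Next Obligation. by apply: lin_eq => x; apply/rowP; case. Qed.
Next Obligation. exact: lin_eq. Qed.
Next Obligation. exact: lin_eq. Qed.
Next Obligation. exact: lin_eq. Qed.
Next Obligation. exact: lin_eq. Qed.
Next Obligation.
by apply: lin_eq => -[x y]; congr pair; rewrite /= ?addr0 ?add0r.
Qed.

(* Right R-modules are left modules over the converse ring: a *: x is x a. *)
Definition rmods (R : pzRingType) : addcat := lmods R^c.

Definition fin_gen (S : pzRingType) (P : lmodType S) :=
  exists (n : nat) (e : 'I_n -> P),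
    forall x, exists a : 'I_n -> S, x = \sum_(i < n) a i *: e i.

Definition projective (S : pzRingType) (P : lmodType S) :=
  forall (U V : lmodType S) (g : {linear U -> V}) (f : {linear P -> V}),
    (forall v, exists u, g u = v) ->
    exists h : {linear P -> U}, forall x, g (h x) = f x.

Definition exact_at (U V W : zmodType) (f : U -> V) (g : V -> W) :=
  forall y, g y = 0 <-> exists x, f x = y.

Section TotallyAcyclic.
Variable R : pzRingType.

Definition regmod : rmods R := (R^c)^o.

Definition acyclic (X : complex (rmods R)) :=
  forall n, exact_at (cd X n : {linear _ -> _}) (cd X (n + 1) : {linear _ -> _}).

Definition dual_acyclic (X : complex (rmods R)) :=
  forall n, exact_at (fun h : hom (X (n + 1 + 1)) regmod => h ∘ cd X (n + 1))
                     (fun h : hom (X (n + 1)) regmod => h ∘ cd X n).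

Definition totally_acyclic (X : complex (rmods R)) :=
  acyclic X /\ dual_acyclic X.

Definition tac_proj (X : Khtpy (rmods R)) :=
  totally_acyclic X /\
  forall n, fin_gen (X n : lmodType R^c) /\ projective (X n : lmodType R^c).

Lemma exact_atN (U V W : zmodType) (f f' : U -> V) (g g' : V -> W) :
  (forall x, f' x = - f x) -> (forall x, f (- x) = - f x) ->
  (forall y, g' y = - g y) -> exact_at f g -> exact_at f' g'.
Proof.
move=> ff' fN gg' fg y; rewrite gg'; split.
  move/eqP; rewrite oppr_eq0 => /eqP /fg [x <-].
  by exists (- x); rewrite ff' fN opprK.
case=> x <-; rewrite ff' -fN; have -> := (fg (f (- x))).2; first by rewrite oppr0.
by exists (- x).
Qed.

Lemma tac_proj_susp (X : Khtpy (rmods R)) : tac_proj X -> tac_proj (susp X).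
Proof.
case=> -[aX dX] pX; split; last by move=> n; exact: pX.
split=> n.
  apply: (exact_atN _ _ _ (aX (n + 1))) => x //=; exact: raddfN.
apply: (exact_atN _ _ _ (dX (n + 1))) => h; [exact: (@compNr (rmods R))|exact: (@compNl (rmods R))|exact: (@compNr (rmods R))].
Qed.

(* As a full subcategory of the homotopy category of all complexes of right
   modules, with the suspension and the distinguished triangles of the latter. *)
Definition Ktac : tricat := fulltri tac_proj_susp.

End TotallyAcyclic.

Definition endr (C : preadd) (M : C) : Type := hom M M.

HB.instance Definition _ (C : preadd) (M : C) := GRing.Zmodule.on (endr M).
HB.instance Definition _ (C : preadd) (M : C) :=
  GRing.Zmodule_isPzRing.Build (endr M)
    (@compA C M M M M) (@comp1m C M M) (@compm1 C M M)
    (fun g g' f => compDl g g' f) (fun g f f' => compDr g f f').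

Definition regular (R : pzRingType) (x : R) := GRing.lreg x /\ GRing.rreg x.

Section Reduction.
Variables (C : addcat) (eta : endonat C) (M : C).

Definition in_etasub (X : C) (w : hom M X) := exists v : hom M X, w = v ∘ eta M.

Lemma etasub0 X : @in_etasub X 0.
Proof. by exists 0; rewrite comp0m. Qed.
Lemma etasubB X (w w' : hom M X) :
  in_etasub w -> in_etasub w' -> in_etasub (w - w').
Proof. by case=> v -> [v' ->]; exists (v - v'); rewrite compBl. Qed.

Definition etasub (X : C) : subgrp (hom M X) := SubGrp (@etasub0 X) (@etasubB X).

Definition ebar (X : C) : Type := quo (etasub X).
HB.instance Definition _ (X : C) := GRing.Zmodule.on (ebar X).

Definition ecls (X : C) (w : hom M X) : ebar X := cls (etasub X) w.

Lemma ecls_eq (X : C) (w w' : hom M X) :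
  (exists v, w - w' = v ∘ eta M) -> ecls w = ecls w'.
Proof. by move=> h; apply/cls_eq. Qed.

Lemma ecls_rep (X : C) (w : hom M X) :
  exists v, rep (ecls w) - w = v ∘ eta M.
Proof. exact: (rep_cls (etasub X)). Qed.

Lemma ebarP (X : C) (x : ebar X) : exists w, x = ecls w.
Proof. by exists (rep x); rewrite /ecls repK. Qed.

Lemma eclsD (X : C) (w w' : hom M X) : ecls (w + w') = ecls w + ecls w'.
Proof. exact: clsD. Qed.

(* Composition w a induces both the multiplication of Γ_M/(η_M), which is the
   case X = M, and its right action on Hom(M, X)/Hom(M, X)η_M. *)
Definition eact (X : C) (x : ebar X) (a : ebar M) : ebar X :=
  ecls (rep x ∘ rep a).

Lemma eactE (X : C) (w : hom M X) (a : hom M M) :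
  eact (ecls w) (ecls a) = ecls (w ∘ a).
Proof.
rewrite /eact; have [v ev] := ecls_rep w; have [b eb] := ecls_rep a.
transitivity (ecls (rep (ecls w) ∘ a)); apply: ecls_eq.
  by exists (rep (ecls w) ∘ b); rewrite -compBr eb compA.
by exists (v ∘ a); rewrite -compBl ev -!compA ntE.
Qed.

Lemma eactA (X : C) (x : ebar X) (a b : ebar M) :
  eact x (eact a b) = eact (eact x a) b.
Proof.
by have [w ->] := ebarP x; have [u ->] := ebarP a; have [v ->] := ebarP b;
  rewrite !eactE compA.
Qed.
Lemma eact1 (X : C) (x : ebar X) : eact x (ecls (idm M)) = x.
Proof. by have [w ->] := ebarP x; rewrite eactE compm1. Qed.
Lemma eact1l (a : ebar M) : eact (ecls (idm M)) a = a.
Proof. by have [w ->] := ebarP a; rewrite eactE comp1m. Qed.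
Lemma eactDl (X : C) (x y : ebar X) (a : ebar M) :
  eact (x + y) a = eact x a + eact y a.
Proof.
by have [w ->] := ebarP x; have [v ->] := ebarP y; have [u ->] := ebarP a;
  rewrite -eclsD !eactE compDl eclsD.
Qed.
Lemma eactDr (X : C) (x : ebar X) (a b : ebar M) :
  eact x (a + b) = eact x a + eact x b.
Proof.
by have [w ->] := ebarP x; have [v ->] := ebarP a; have [u ->] := ebarP b;
  rewrite -eclsD !eactE compDr eclsD.
Qed.

(* Since η_M is central, the two-sided ideal (η_M) is Γ_M η_M = etasub M. *)
Definition gbar : Type := ebar M.
HB.instance Definition _ := GRing.Zmodule.on gbar.
HB.instance Definition _ := GRing.Zmodule_isPzRing.Build gbar
  (@eactA M) eact1l (@eact1 M) (@eactDl M) (@eactDr M).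

HB.instance Definition _ (X : C) :=
  GRing.Zmodule_isLmodule.Build gbar^c (ebar X)
    (fun a b x => esym (eactA x b a)) (@eact1 X)
    (fun a x y => eactDl x y a) (fun x a b => eactDr x a b).

Definition ebarm (X Y : C) (f : hom X Y) (x : ebar X) : ebar Y :=
  ecls (f ∘ rep x).

Lemma ebarmE (X Y : C) (f : hom X Y) (w : hom M X) :
  ebarm f (ecls w) = ecls (f ∘ w).
Proof.
have [v ev] := ecls_rep w; apply: ecls_eq.
by exists (f ∘ v); rewrite -compBr ev compA.
Qed.

Lemma ebarm_linear (X Y : C) (f : hom X Y) :
  linear (ebarm f : ebar X -> ebar Y).
Proof.
move=> a x y; have [w ->] := ebarP x; have [v ->] := ebarP y.
have [u ->] := ebarP a.
change (ebarm f (eact (ecls w) (ecls u) + ecls v)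
        = eact (ebarm f (ecls w)) (ecls u) + ebarm f (ecls v)).
by rewrite eactE -eclsD !ebarmE eactE -eclsD compDr compA.
Qed.

Program Definition ebar_fun : functor C (rmods gbar) :=
  @Functor C (rmods gbar) (fun X => (ebar X : lmodType gbar^c))
    (fun X Y f => mklin (@ebarm_linear X Y f)) _ _ _.
Next Obligation.
by apply: lin_eq => x; have [w ->] := ebarP x; rewrite /= ebarmE comp1m.
Qed.
Next Obligation.
by apply: lin_eq => x; have [w ->] := ebarP x; rewrite /= !ebarmE compA.
Qed.
Next Obligation.
by apply: lin_eq => x; have [w ->] := ebarP x; rewrite /= !ebarmE compDl eclsD.
Qed.

Lemma ebar_eta (X : C) : fmap ebar_fun (eta X) = 0.
Proof.
apply: lin_eq => x; have [w ->] := ebarP x; rewrite /= ebarmE.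
by apply/cls_eq0; exists w; rewrite ntE.
Qed.

Definition Hom_mod_eta : functor (HFact eta) (Khtpy (rmods gbar)) :=
  periodic ebar_eta.

End Reduction.

(* Main.v *)
From mathcomp Require Import all_boot all_order all_algebra.
From mathcomp Require Import boolp.
Require Import Defs.

(** Write e for the reduction of Hom(M, -) modulo eta_M. Every object X is a
    direct summand of a power of M, so the identity of X is a finite sum of
    composites X -> M -> X. With this splitting one checks on components that
    e(X) is finitely generated projective, that e is full, that its kernel on
    Hom(X, Y) consists of the multiples of eta (ebar_fin_gen, ebar_projective,
    ebar_full, ebar_ker), and that f eta_X = 0 implies f = 0, regularity of eta_M
    being the case X = Y = M (eta_cancel).

    So morphisms between reductions may be replaced by morphisms of C, at the
    cost of an error h eta. In a factorization eta is d_2 d_1 or d_1 d_2, and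
    d_1, d_2 are cancellable because eta is; the error can therefore be absorbed
    by a correction h d_i and the resulting identity holds strictly in C. This
    one computation gives all that is needed: exactness of the periodic complex
    (ebar_exact), the extension and lifting properties of its differentials
    (factor_extend, factor_lift), of which the case of target M is exactness of
    the dual, strict lifts of commutative squares to morphisms of factorizations
    (fact_lift), and lifts of contractions (fnull_lift).

    For fullness, a chain map between periodic complexes need not be periodic.
    Its square in degrees 0 and 1 lifts to a morphism of factorizations; the
    difference vanishes in degree 0, and the extension and lifting properties
    contract it in both directions (chnull_of_vanishing). For faithfulness, a
    contraction in one degree already lifts.

    Triangles are preserved by any additive functor killing eta in place of e:
    suspensions and cones are taken to suspensions and cones up to the evident
    degreewise isomorphisms (periodic_triangle). *)

Set Implicit Arguments.
Unset Strict Implicit.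
Unset Printing Implicit Defensive.

Import GRing.Theory.
Local Open Scope ring_scope.

(** * Two-sided dependent choice over the integers *)

Section IntChain.
Variables (A : int -> Type) (R : forall n, A n -> A (n + 1) -> Prop).

(* The index m is kept apart from n + 1 because the successors met below are
   equal to n + 1 only up to a proof: k.+1 for n = k, and Negz k for
   n = Negz k.+1. *)
Let rel_over n m (e : n + 1 = m) (a : A n) : A m -> Prop :=
  match e in _ = m return A m -> Prop with erefl => @R n a end.

(** A relation between consecutive members of a family of types that can be
    solved both forwards and backwards is solved along all of the integers:
    start in degree 0 and choose outwards. Homotopies between complexes that
    are unbounded in both directions are built in this way. *)
Lemma int_chain : A 0 ->
    (forall n (a : A n), exists b, R a b) ->
    (forall n (b : A (n + 1)), exists a, R a b) ->
  exists s : forall n, A n, forall n, R (s n) (s (n + 1)).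
Proof.
move=> a0 Rnext Rprev.
have next_over n m (e : n + 1 = m) (a : A n) : {b | rel_over e a b}.
  by case: m / e; apply: cid; exact: Rnext.
have prev_over n m (e : n + 1 = m) (b : A m) : {a | rel_over e a b}.
  by case: m / e b => b; apply: cid; exact: Rprev.
have eP k : k%:Z + 1 = k.+1%:Z by rewrite -PoszD addn1.
have eN0 : Negz 0 + 1 = 0%:Z by [].
have eNS k : Negz k.+1 + 1 = Negz k.
  by rewrite !NegzE -addn1 PoszD opprD addrNK.
pose up := fix up k : A k%:Z :=
  if k is k'.+1 then sval (next_over _ _ (eP k') (up k')) else a0.
pose down := fix down k : A (Negz k) :=
  if k is k'.+1 then sval (prev_over _ _ (eNS k') (down k'))
  else sval (prev_over _ _ eN0 a0).
pose s n : A n := match n with Posz k => up k | Negz k => down k end.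
exists s.
have sP n m (e : n + 1 = m) : rel_over e (s n) (s m) -> R (s n) (s (n + 1)).
  by case: m / e.
case=> [k|[|k]].
- by apply: (sP _ _ (eP k)); exact: svalP (next_over _ _ (eP k) (up k)).
- by apply: (sP _ _ eN0); exact: svalP (prev_over _ _ eN0 a0).
- by apply: (sP _ _ (eNS k)); exact: svalP (prev_over _ _ (eNS k) (down k)).
Qed.

End IntChain.

(** * The additive closure of an object *)

Section Sums.
Variable C : preadd.

Lemma comp_suml (X Y Z : C) n (g : 'I_n -> hom Y Z) (f : hom X Y) :
  (\sum_k g k) ∘ f = \sum_k g k ∘ f.
Proof.
by apply: (big_morph (fun h => h ∘ f)) => [g1 g2|];
  [exact: compDl|exact: comp0m].
Qed.

Lemma comp_sumr (X Y Z : C) n (g : hom Y Z) (f : 'I_n -> hom X Y) :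
  g ∘ (\sum_k f k) = \sum_k g ∘ f k.
Proof.
by apply: (big_morph (fun h => g ∘ h)) => [g1 g2|];
  [exact: compDr|exact: compm0].
Qed.

End Sums.

Section AddClosure.
Variable C : addcat.

(** The a_k are the components of a split epimorphism from the n-th power of M
    onto X, the b_k those of a section of it. *)
Definition add_split (M X : C) n (a : 'I_n -> hom M X) (b : 'I_n -> hom X M) :=
  \sum_k a k ∘ b k = idm X.

Lemma bpow_split (M : C) n :
  exists (a : 'I_n -> hom M (bpow M n)) (b : 'I_n -> hom (bpow M n) M),
    add_split a b.
Proof.
elim: n => [|n [a [b ab]]].
  by exists (fun=> 0), (fun=> 0); rewrite /add_split big_ord0 /= zobE.
exists (fun k => if unlift ord0 k is Some j then in2 _ _ ∘ a j else in1 _ _).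
exists (fun k => if unlift ord0 k is Some j then b j ∘ pr2 _ _ else pr1 _ _).
rewrite /add_split big_ord_recl unlift_none /= -bipE; congr (_ + _).
rewrite -[in RHS](comp1m (pr2 _ _)) -ab comp_suml comp_sumr.
by apply: eq_bigr => k _; rewrite liftK !compA.
Qed.

Lemma in_add_split (M X : C) : in_add M X ->
  exists n (a : 'I_n -> hom M X) (b : 'I_n -> hom X M), add_split a b.
Proof.
case=> n [i [p [_ pi]]]; have [a [b ab]] := bpow_split M n.
exists n, (fun k => p ∘ a k), (fun k => b k ∘ i).
rewrite /add_split -pi -[in RHS](comp1m i) -ab comp_suml comp_sumr.
by apply: eq_bigr => k _; rewrite !compA.
Qed.

End AddClosure.

(** * Reduction of Hom(M, -) modulo eta *)

Section Regular.
Variables (C : addcat) (eta : endonat C) (M : C).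
Hypothesis C_add_M : forall X : C, in_add M X.
Hypothesis eta_M_regular : regular (eta M : endr M).

(** Sandwiching f between the components of splittings of X and Y gives
    endomorphisms of M killed by eta_M, and these vanish by regularity. *)
Lemma eta_cancel (X Y : C) (f : hom X Y) : f ∘ eta X = 0 -> f = 0.
Proof.
move=> f0; have [n [a [b ab]]] := in_add_split (C_add_M X).
have [m [a' [b' ab']]] := in_add_split (C_add_M Y).
rewrite -(compm1 f) -ab comp_sumr big1 // => k _.
rewrite -(comp1m (f ∘ _)) -ab' comp_suml big1 // => l _.
suff e0 : b' l ∘ (f ∘ a k) = 0.
  by rewrite -compA (compA f) (compA (b' l)) e0 comp0m compm0.
apply: (eta_M_regular.2 _ 0 _).
change ((b' l ∘ (f ∘ a k)) ∘ eta M = 0 ∘ eta M).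
by rewrite -!compA -ntE (compA f) f0 !(comp0m, compm0).
Qed.

Local Notation ebar_map f := (fmap (ebar_fun eta M) f : {linear _ -> _}).

Lemma ebar_mapE (X Y : C) (f : hom X Y) (w : hom M X) :
  ebar_map f (ecls eta w) = ecls eta (f ∘ w).
Proof. exact: ebarmE. Qed.

(** If f kills the reduction, then f a_k = v_k eta_M for every k; recombining
    along the splitting, and moving eta across the b_k, gives f = g eta_X with
    g the sum of the v_k b_k. *)
Lemma ebar_ker (X Y : C) (f : hom X Y) :
  fmap (ebar_fun eta M) f = 0 -> exists g, f = g ∘ eta X.
Proof.
move=> f0; have [n [a [b ab]]] := in_add_split (C_add_M X).
have /choice [v fa] k : exists v, f ∘ a k = v ∘ eta M.
  by apply/(cls_eq0 (etasub eta M Y)); rewrite -/(ecls _ _) -ebar_mapE f0.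
exists (\sum_k v k ∘ b k).
rewrite -(compm1 f) -ab comp_sumr comp_suml; apply: eq_bigr => k _.
by rewrite compA fa -!compA ntE.
Qed.

Lemma ecls_scale (X : C) (w : hom M X) (c : hom M M) :
  ecls eta (w ∘ c) =
    @GRing.scale ((gbar eta M)^c : pzRingType)
      (ebar eta M X : lmodType (gbar eta M)^c) (ecls eta c) (ecls eta w).
Proof. by rewrite -eactE. Qed.

Lemma ecls_sum (X : C) n (w : 'I_n -> hom M X) :
  ecls eta (\sum_k w k) = \sum_k ecls eta (w k).
Proof.
by apply: (big_morph (fun w => ecls eta w)) => [u v|];
  [exact: eclsD|exact: cls0].
Qed.

(** The classes of the a_k generate the reduction of Hom(M, X), and the b_k
    induce coordinates with respect to them: a linear map is known from its
    values on the a_k, and these are lifted one at a time below. *)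
Lemma ebar_coord (X : C) n (a : 'I_n -> hom M X) (b : 'I_n -> hom X M)
    (V : lmodType (gbar eta M)^c) (phi : {linear ebar eta M X -> V})
    (w : hom M X) : add_split a b ->
  phi (ecls eta w) =
    \sum_k (ecls eta (b k ∘ w) : (gbar eta M)^c) *: phi (ecls eta (a k)).
Proof.
move=> ab; rewrite -[in LHS](comp1m w) -ab comp_suml ecls_sum raddf_sum.
apply: eq_bigr => k _; rewrite -compA ecls_scale; exact: linearZ_LR phi _ _.
Qed.

Lemma ebar_full (X Y : C) (phi : hom (ebar_fun eta M X) (ebar_fun eta M Y)) :
  exists f : hom X Y, phi = fmap (ebar_fun eta M) f.
Proof.
have [n [a [b ab]]] := in_add_split (C_add_M X).
have /choice [w phia] k : exists w,
    (phi : {linear _ -> _}) (ecls eta (a k)) = ecls eta w.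
  exact: ebarP.
exists (\sum_k w k ∘ b k); apply: lin_eq => x; have [u ->] := ebarP x.
rewrite ebar_mapE comp_suml ecls_sum.
rewrite (ebar_coord (phi : {linear ebar eta M X -> ebar eta M Y}) u ab).
by apply: eq_bigr => k _; rewrite -compA ecls_scale -phia.
Qed.

Lemma ebar_fin_gen (X : C) :
  fin_gen (ebar eta M X : lmodType (gbar eta M)^c).
Proof.
have [n [a [b ab]]] := in_add_split (C_add_M X).
exists n, (fun k => ecls eta (a k)) => x;
have [w ->] := ebarP x.
by eexists; exact: (ebar_coord idfun w ab).
Qed.

Lemma ebar_projective (X : C) :
  projective (ebar eta M X : lmodType (gbar eta M)^c).
Proof.
move=> U V g f gsurj; have [n [a [b ab]]] := in_add_split (C_add_M X).
have /choice [u gu] k : exists u, g u = f (ecls eta (a k)) by exact: gsurj.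
(* Scalars act on the classes in Hom(M, M) by composition, so that b_k induces
   a linear form. *)
pose c k : {linear ebar eta M X -> ((gbar eta M)^c)^o} :=
  fmap (ebar_fun eta M) (b k).
pose h x := \sum_k c k x *: u k.
have hL : linear h.
  move=> r x y; rewrite /h scaler_sumr -big_split; apply: eq_bigr => k _.
  by rewrite linearP scalerDl scalerA.
exists (mklin hL) => x; have [w ->] := ebarP x.
rewrite (ebar_coord f w ab).
have -> : mklin hL (ecls eta w) =
    \sum_k (ecls eta (b k ∘ w) : (gbar eta M)^c) *: u k.
  by apply: eq_bigr => k _; rewrite ebar_mapE.
rewrite raddf_sum; apply: eq_bigr => k _.
by rewrite -gu; exact: linearZ_LR g _ _.
Qed.

End Regular.

(** * Isomorphisms, and homotopy classes as morphisms *)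

Lemma is_iso_comp (C : preadd) (X Y Z : C) (g : hom Y Z) (f : hom X Y) :
  is_iso g -> is_iso f -> is_iso (g ∘ f).
Proof.
case=> g' g'g gg' [f' f'f ff']; exists (f' ∘ g').
  by rewrite compA -(compA f') g'g compm1.
by rewrite compA -(compA g) ff' compm1.
Qed.

Lemma is_iso_fmap (C D : preadd) (F : functor C D) (X Y : C) (f : hom X Y) :
  is_iso f -> is_iso (fmap F f).
Proof.
by case=> g gf fg; exists (fmap F g); rewrite -fmapM ?gf ?fg fmap1.
Qed.

Lemma is_iso_qcls (C : preadd) (I : ideal C) (X Y : C) (f : hom X Y) :
  is_iso f -> @is_iso (quotcat I) X Y (qcls I f).
Proof.
by case=> g gf fg; exists (qcls I g); rewrite /= qcompE ?gf ?fg.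
Qed.

Lemma chmap_iso (A : addcat) (X Y : complex A) (u : chmap X Y)
    (v : forall n, hom (Y n) (X n)) :
  (forall n, v n ∘ u n = idm _) -> (forall n, u n ∘ v n = idm _) ->
  @is_iso (chcat A) X Y u.
Proof.
move=> vu uv.
have vE n : v (n + 1) ∘ cd Y n = cd X n ∘ v n.
  by rewrite -[LHS]compm1 -uv compA -(compA _ (cd Y n)) -cmE compA vu comp1m.
by exists (ChMap vE); apply: chmap_eq => n; [exact: vu|exact: uv].
Qed.

Definition kcls (A : addcat) (X Y : complex A) (u : chmap X Y) :
  @hom (Khtpy A) X Y := @qcls (chcat A) (chhtpy A) X Y u.

Lemma kcls_comp (A : addcat) (X Y Z : complex A)
    (v : chmap Y Z) (u : chmap X Y) :
  kcls v ∘ kcls u = kcls (chcomp v u).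
Proof. exact: (@qcompE (chcat A) (chhtpy A)). Qed.

Lemma kcls_susp (A : addcat) (X Y : complex A) (u : chmap X Y) :
  fmap susp (kcls u) = kcls (shiftm u).
Proof. exact: (qfmapE (@shift_null A)). Qed.

Lemma kcls_surj (A : addcat) (X Y : complex A) (f : @hom (Khtpy A) X Y) :
  exists u, f = kcls u.
Proof. by exists (rep f); rewrite /kcls /qcls repK. Qed.

Section FactClass.
Variables (C : addcat) (eta : endonat C).

Definition fcls (X Y : fact eta) (u : fmor X Y) :
  @hom (HFact eta) X Y := @qcls (factcat eta) (fhtpy eta) X Y u.

Lemma fcls_susp (X Y : fact eta) (u : fmor X Y) :
  fmap susp (fcls u) = fcls (fshiftm u).
Proof. exact: (qfmapE (@fshift_null _ eta)). Qed.

Lemma fcls_surj (X Y : fact eta) (f : @hom (HFact eta) X Y) :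
  exists u, f = fcls u.
Proof. by exists (rep f); rewrite /fcls /qcls repK. Qed.

End FactClass.

(** * The 2-periodic complex functor preserves triangles *)

Section PeriodicTriangle.
Variables (C : addcat) (eta : endonat C) (A : addcat) (G : functor C A).
Hypothesis Geta : forall X : C, fmap G (eta X) = 0.

(** Both sides have the same objects, since n + 1 and n have opposite
    parities; but the types agree only once the parities b of n and b' of n + 1
    are known. The comparison is therefore a family of identities indexed by b
    and b', and the remaining cases never occur. *)
Definition per_shift_b (X : fact eta) (b b' : bool) :
    hom (per_ob G (fshift X) b) (per_ob G X b') :=
  match b, b' with
  | false, true => idm _
  | true, false => idm _
  | _, _ => 0
  end.

Program Definition per_shift (X : fact eta) :
    chmap (per Geta (fshift X)) (shift (per Geta X)) :=
  @ChMap A (per Geta (fshift X)) (shift (per Geta X))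
    (fun n => per_shift_b X (par n) (par (n + 1))) _.
Next Obligation.
by rewrite !parS; case: (par n) => /=; rewrite comp1m compm1 fmapN.
Qed.

Lemma per_shift_iso (X : fact eta) : @is_iso (chcat A) _ _ (per_shift X).
Proof.
pose v b b' : hom (per_ob G X b') (per_ob G (fshift X) b) :=
  match b, b' with
  | false, true => idm _
  | true, false => idm _
  | _, _ => 0
  end.
apply: (@chmap_iso _ _ _ (per_shift X)
  (fun n => v (par n) (par (n + 1)))) => n /=;
  by rewrite parS; case: (par n); exact: comp1m.
Qed.

Lemma per_shift_nat (X Y : fact eta) (u : fmor X Y) :
  chcomp (per_shift Y) (per_map Geta (fshiftm u)) =
  chcomp (shiftm (per_map Geta u)) (per_shift X).
Proof.
apply: chmap_eq => n /=; rewrite parS.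
by case: (par n); rewrite /= comp1m compm1.
Qed.

Definition bip_cmp (X Y : C) : hom (G (bip X Y)) (bip (G X) (G Y)) :=
  in1 _ _ ∘ fmap G (pr1 X Y) + in2 _ _ ∘ fmap G (pr2 X Y).

Definition bip_cmpV (X Y : C) : hom (bip (G X) (G Y)) (G (bip X Y)) :=
  fmap G (in1 X Y) ∘ pr1 _ _ + fmap G (in2 X Y) ∘ pr2 _ _.

Lemma pr1_bip_cmp (X Y : C) : pr1 _ _ ∘ bip_cmp X Y = fmap G (pr1 X Y).
Proof. by rewrite compDr !compA pr1in1 pr1in2 comp1m comp0m addr0. Qed.

Lemma pr2_bip_cmp (X Y : C) : pr2 _ _ ∘ bip_cmp X Y = fmap G (pr2 X Y).
Proof. by rewrite compDr !compA pr2in1 pr2in2 comp1m comp0m add0r. Qed.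

Lemma bip_cmpVK (X Y : C) : bip_cmpV X Y ∘ bip_cmp X Y = idm _.
Proof.
rewrite /bip_cmpV compDl -!compA pr1_bip_cmp pr2_bip_cmp -!fmapM -fmapD bipE.
exact: fmap1.
Qed.

Lemma bip_cmpK (X Y : C) : bip_cmp X Y ∘ bip_cmpV X Y = idm _.
Proof.
apply: to_bip_eq; rewrite compA ?pr1_bip_cmp ?pr2_bip_cmp compm1 compDr !compA
  -!fmapM.
  by rewrite pr1in1 pr1in2 fmap0 fmap1 comp1m comp0m addr0.
by rewrite pr2in1 pr2in2 fmap0 fmap1 comp1m comp0m add0r.
Qed.

Lemma bip_cmp_in2 (X Y : C) : bip_cmp X Y ∘ fmap G (in2 X Y) = in2 _ _.
Proof.
by rewrite compDl -!compA -!fmapM pr1in2 pr2in2 fmap0 fmap1 compm0 compm1 add0r.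
Qed.

Lemma bip_cmp_bmx (X Y Z W : C) (a : hom X Z) (b : hom Y Z)
    (c : hom X W) (d : hom Y W) :
  bip_cmp Z W ∘ fmap G (bmx a b c d) =
  bmx (fmap G a) (fmap G b) (fmap G c) (fmap G d) ∘ bip_cmp X Y.
Proof.
by apply: to_bip_eq;
  rewrite !compA ?pr1_bip_cmp ?pr2_bip_cmp ?pr1_bmx ?pr2_bmx
    -fmapM ?pr1_bmx ?pr2_bmx fmapD !fmapM compDl -!compA
    pr1_bip_cmp pr2_bip_cmp.
Qed.

Section Cone.
Variables (X Y : fact eta) (u : fmor X Y).

(** The cone of a factorization morphism goes to the cone of the chain map up to
    the biproduct comparison in each degree; the isomorphism is strict on the
    level of chain maps, no homotopy being involved. *)
Definition cone_cmp_b (b b' : bool) :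
    hom (per_ob G (fcone u) b) (bip (per_ob G X b') (per_ob G Y b)) :=
  match b, b' with
  | false, true => bip_cmp _ _
  | true, false => bip_cmp _ _
  | _, _ => 0
  end.

Program Definition cone_cmp :
    chmap (per Geta (fcone u)) (cone (per_map Geta u)) :=
  @ChMap A (per Geta (fcone u)) (cone (per_map Geta u))
    (fun n => cone_cmp_b (par n) (par (n + 1))) _.
Next Obligation.
by rewrite !parS; case: (par n) => /=; rewrite bip_cmp_bmx fmap0 fmapN.
Qed.

Lemma cone_cmp_iso : @is_iso (chcat A) _ _ cone_cmp.
Proof.
pose v b b' : hom (bip (per_ob G X b') (per_ob G Y b)) (per_ob G (fcone u) b) :=
  match b, b' with
  | false, true => bip_cmpV _ _
  | true, false => bip_cmpV _ _
  | _, _ => 0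
  end.
apply: (@chmap_iso _ _ _ cone_cmp (fun n => v (par n) (par (n + 1)))) => n /=;
  by rewrite parS; case: (par n); rewrite /= ?bip_cmpVK ?bip_cmpK.
Qed.

Lemma cone_cmp_in :
  chcomp cone_cmp (per_map Geta (fcone_in u)) = cone_in (per_map Geta u).
Proof.
apply: chmap_eq => n /=; rewrite parS.
by case: (par n); rewrite /= bip_cmp_in2.
Qed.

Lemma cone_cmp_pr :
  chcomp (per_shift X) (per_map Geta (fcone_pr u)) =
  chcomp (cone_pr (per_map Geta u)) cone_cmp.
Proof.
apply: chmap_eq => n /=; rewrite parS.
by case: (par n); rewrite /= pr1_bip_cmp comp1m.
Qed.

End Cone.

Lemma periodic_fcls (X Y : fact eta) (u : fmor X Y) :
  fmap (periodic Geta) (fcls u) = kcls (per_map Geta u).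
Proof. exact: (qfmapE (@per_null _ _ _ _ Geta)). Qed.

Lemma periodic_susp (X Y : HFact eta) (f : hom X Y) :
  kcls (per_shift Y) ∘ fmap (periodic Geta) (fmap susp f) =
  fmap susp (fmap (periodic Geta) f) ∘ kcls (per_shift X).
Proof.
have [u ->] := fcls_surj f.
by rewrite fcls_susp !periodic_fcls kcls_susp !kcls_comp per_shift_nat.
Qed.

(** For a standard triangle the isomorphism of triangles is the identity at the
    first two vertices and the comparison of cones at the third. An arbitrary
    triangle is first moved to a standard one, which naturality of the
    comparison of suspensions permits. *)
Theorem periodic_triangle : triangle_functor (periodic Geta).
Proof.
exists (fun X => kcls (per_shift X)); split=> [X|X Y f|t].
- by apply: is_iso_qcls; exact: per_shift_iso.
- exact: periodic_susp.
case=> X [Y [u [a [b [c [[ia ib ic] [ab bc ca]]]]]]].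
exists (per Geta X), (per Geta Y), (per_map Geta u).
exists (fmap (periodic Geta) a), (fmap (periodic Geta) b).
exists (@comp (Khtpy A) _ _ _ (kcls (cone_cmp u)) (fmap (periodic Geta) c)).
split; split.
- exact: is_iso_fmap.
- exact: is_iso_fmap.
- by apply: is_iso_comp; [apply/is_iso_qcls/cone_cmp_iso|exact: is_iso_fmap].
- rewrite -[LHS](fmapM (periodic Geta)) ab fmapM.
  by congr (_ ∘ _); exact: periodic_fcls.
- rewrite -[LHS]compA -fmapM bc fmapM [LHS]compA.
  congr (_ ∘ _); rewrite (periodic_fcls (fcone_in u)) kcls_comp.
  by rewrite cone_cmp_in.
- rewrite [LHS]compA -periodic_susp -compA -fmapM ca fmapM.
  rewrite [RHS]compA [LHS]compA.
  congr (_ ∘ _); rewrite (periodic_fcls (fcone_pr u)).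
  by rewrite !kcls_comp cone_cmp_pr.
Qed.

End PeriodicTriangle.

(** * Homotopies between unbounded complexes *)

(** The usual comparison argument, in both directions from degree 0. From the
    component s of a homotopy that leaves degree n + 1 one gets the next one if
    (u_(n+1) - d s) d = 0, and the previous one if d (u_n - s d) = 0. As u is a
    chain map, both conditions say d u_n = d s d, so one invariant serves on
    either side. *)
Lemma chnull_of_vanishing (A : addcat) (P Q : complex A) (u : chmap P Q) :
    (forall n (f : hom (P (n + 1)) (Q (n + 1))), f ∘ cd P n = 0 ->
       exists g, f = g ∘ cd P (n + 1)) ->
    (forall n (f : hom (P (n + 1)) (Q (n + 1))), cd Q (n + 1) ∘ f = 0 ->
       exists g, f = cd Q n ∘ g) ->
  u 0 = 0 -> chnull u.
Proof.
move=> extend lift u0.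
pose good n (s : hom (P (n + 1)) (Q n)) :=
  cd Q n ∘ u n = cd Q n ∘ s ∘ cd P n.
pose step n (s : {s | good n s}) (t : {t | good (n + 1) t}) :=
  u (n + 1) = cd Q n ∘ sval s + sval t ∘ cd P (n + 1).
have [| | |s sP] := @int_chain (fun n => {s | good n s}) step.
- by exists 0; rewrite /good u0 !(compm0, comp0m).
- move=> n [s gs].
  have [|t et] := extend n (u (n + 1) - cd Q n ∘ s).
    by rewrite compBl cmE gs subrr.
  have ut : u (n + 1) = cd Q n ∘ s + t ∘ cd P (n + 1).
    by rewrite -et [RHS]addrC subrK.
  suff gt : good (n + 1) t by exists (exist _ t gt).
  by rewrite /good ut compDr !compA cdd comp0m add0r.
- move=> n [t gt].
  have [|s es] := lift n (u (n + 1) - t ∘ cd P (n + 1)).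
    by rewrite compBr gt compA subrr.
  have us : u (n + 1) = cd Q n ∘ s + t ∘ cd P (n + 1).
    by rewrite -es subrK.
  suff gs : good n s by exists (exist _ s gs).
  by rewrite /good -cmE us compDl -!compA cdd compm0 addr0.
by exists (fun n => sval (s n)).
Qed.

(** * Full faithfulness from lifting modulo eta *)

(** The functor G is full with kernel the multiples of eta, and eta is
    cancellable. Everything about the periodic complexes can then be computed in
    C up to multiples of eta, and these are removed by means of eta = d d'. *)
Section FullyFaithful.
Variables (C : addcat) (eta : endonat C) (A : addcat) (G : functor C A).
Hypothesis Geta : forall X : C, fmap G (eta X) = 0.
Hypothesis Gfull : forall (X Y : C) (phi : hom (G X) (G Y)),
  exists f, phi = fmap G f.
Hypothesis Gker : forall (X Y : C) (f : hom X Y),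
  fmap G f = 0 -> exists g, f = g ∘ eta X.
Hypothesis eta_epi : forall (X Y : C) (f : hom X Y), f ∘ eta X = 0 -> f = 0.

Lemma eta_mono (X Y : C) (f : hom X Y) : eta Y ∘ f = 0 -> f = 0.
Proof. by rewrite ntE; exact: eta_epi. Qed.

Section Factor.
Variables (U V : C) (d : hom U V) (d' : hom V U).
Hypotheses (d'd : d' ∘ d = eta U) (dd' : d ∘ d' = eta V).

Lemma factor_epi (W : C) (f : hom V W) : f ∘ d = 0 -> f = 0.
Proof. by move=> fd; apply: eta_epi; rewrite -dd' compA fd comp0m. Qed.

Lemma factor_mono (W : C) (f : hom W U) : d ∘ f = 0 -> f = 0.
Proof. by move=> df; apply: eta_mono; rewrite -d'd -compA df compm0. Qed.

(** If f d = g eta for a lift f of phi, then f d = g d' d, and f = g d' as d is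
    an epimorphism: exactness of the periodic complexes holds already in C. *)
Lemma factor_extend (W : C) (phi : hom (G V) (G W)) :
  phi ∘ fmap G d = 0 -> exists psi, phi = psi ∘ fmap G d'.
Proof.
have [f ->] := Gfull phi; rewrite -fmapM => /Gker [g].
rewrite -d'd compA => /eqP; rewrite -subr_eq0 -compBl => /eqP /factor_epi.
move=> /eqP; rewrite subr_eq0 => /eqP ->.
by exists (fmap G g); rewrite fmapM.
Qed.

Lemma factor_lift (W : C) (phi : hom (G W) (G U)) :
  fmap G d ∘ phi = 0 -> exists psi, phi = fmap G d' ∘ psi.
Proof.
have [f ->] := Gfull phi; rewrite -fmapM => /Gker [g].
rewrite -ntE -dd' -compA => /eqP; rewrite -subr_eq0 -compBr => /eqP /factor_mono.
move=> /eqP; rewrite subr_eq0 => /eqP ->.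
by exists (fmap G g); rewrite fmapM.
Qed.

End Factor.

Lemma per_image (X : fact eta) n : exists W, per Geta X n = G W :> A.
Proof. by rewrite /=; case: (par n); [exists (f_2 X)|exists (f_1 X)]. Qed.

Lemma per_extend (X : fact eta) (W : C) n
    (phi : hom (per Geta X (n + 1)) (G W)) :
    phi ∘ cd (per Geta X) n = 0 ->
  exists psi, phi = psi ∘ cd (per Geta X) (n + 1).
Proof.
move: phi => /=; rewrite !parS negbK; case: (par n) => /= phi.
- exact: factor_extend (d_12 X) (d_21 X) _ _.
- exact: factor_extend (d_21 X) (d_12 X) _ _.
Qed.

Lemma per_lift (X : fact eta) (W : C) n
    (phi : hom (G W) (per Geta X (n + 1))) :
    cd (per Geta X) (n + 1) ∘ phi = 0 ->
  exists psi, phi = cd (per Geta X) n ∘ psi.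
Proof.
move: phi => /=; rewrite !parS negbK; case: (par n) => /= phi.
- exact: factor_lift (d_21 X) (d_12 X) _ _.
- exact: factor_lift (d_12 X) (d_21 X) _ _.
Qed.

Lemma per_chnull (X Y : fact eta) (u : chmap (per Geta X) (per Geta Y)) :
  u 0 = 0 -> chnull u.
Proof.
apply: chnull_of_vanishing => n.
  by have [W ->] := per_image Y (n + 1); exact: per_extend.
by have [W ->] := per_image X (n + 1); exact: per_lift.
Qed.

(** Lifts u1 and u2 satisfy u2 d_1 - d_1 u1 = h eta = h d_2 d_1, so u2 - h d_2
    commutes with d_1 strictly. Commutation with d_2 then follows by cancelling
    d_1. The correction h d_2 moves the second component away from phi2, which is
    why only the first one is asserted. *)
Lemma fact_lift (X Y : fact eta) (phi1 : hom (G (f_1 X)) (G (f_1 Y)))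
    (phi2 : hom (G (f_2 X)) (G (f_2 Y))) :
    phi2 ∘ fmap G (d_1 X) = fmap G (d_1 Y) ∘ phi1 ->
  exists u : fmor X Y, fmap G (m_1 u) = phi1.
Proof.
have [u1 ->] := Gfull phi1; have [u2 ->] := Gfull phi2.
rewrite -!fmapM => /eqP; rewrite -subr_eq0 -fmapB => /eqP /Gker [h].
rewrite -d_21 => /eqP; rewrite compA subr_eq addrC -subr_eq -compBl => /eqP u21.
suff u12 : u1 ∘ d_2 X = d_2 Y ∘ (u2 - h ∘ d_2 X) by exists (FMor u21 u12).
apply/eqP; rewrite -subr_eq0; apply/eqP/(factor_epi (d_12 X)).
by rewrite compBl -!compA u21 d_21 compA d_21 ntE subrr.
Qed.

(** A contraction in a single degree is enough. For lifts s1 and s2 the defect is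
    h eta = h d_1 d_2, which s2 + h d_1 absorbs; the equation in the other degree
    follows by cancelling d_1. *)
Lemma fnull_lift (X Y : fact eta) (u : fmor X Y)
    (psi1 : hom (G (f_2 X)) (G (f_1 Y))) (psi2 : hom (G (f_1 X)) (G (f_2 Y))) :
    fmap G (m_2 u) = fmap G (d_1 Y) ∘ psi1 + psi2 ∘ fmap G (d_2 X) ->
  fnull u.
Proof.
have [s1 ->] := Gfull psi1; have [s2 ->] := Gfull psi2.
rewrite -!fmapM -fmapD => /eqP; rewrite -subr_eq0 -fmapB => /eqP /Gker [h].
rewrite -d_12 => /eqP; rewrite compA subr_eq => /eqP m2E.
have {m2E} m2E : m_2 u = (s2 + h ∘ d_1 X) ∘ d_2 X + d_1 Y ∘ s1.
  by rewrite m2E compDl [X in _ + X = _]addrC addrA; congr (_ + _); exact: addrC.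
exists s1, (s2 + h ∘ d_1 X); split=> //.
apply/eqP; rewrite -subr_eq0; apply/eqP/(factor_mono (d_21 Y)).
rewrite compBr -m_21 m2E compDl compDr -!compA d_21 -ntE !compA d_12.
by rewrite [X in _ - X]addrC subrr.
Qed.

(** A chain map between periodic complexes is determined up to homotopy by its
    component in degree 0, so for fullness it suffices to lift the square in
    degrees 0 and 1. *)
Theorem periodic_fully_faithful : fully_faithful (periodic Geta).
Proof.
move=> X Y; set F := fun f => _.
have Finj : injective F.
  move=> f g; have [u ->] := fcls_surj f; have [v ->] := fcls_surj g.
  rewrite /F !periodic_fcls => /cls_eq [s sE]; apply/cls_eq.
  apply: (@fnull_lift X Y (u - v) (s 0) (s (0 + 1))).
  by rewrite fmapB; exact: sE 0.
have Fsurj f : exists g, F g = f.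
  have [v ->] := kcls_surj f.
  have [u uE] := @fact_lift X Y (v 0) (v (0 + 1)) (cmE v 0).
  exists (fcls u); rewrite /F periodic_fcls; apply/cls_eq.
  by apply: per_chnull; rewrite /= uE subrr.
have [g gK] := choice Fsurj.
by exists g => // f; apply: Finj; rewrite gK.
Qed.

End FullyFaithful.

(** * Total acyclicity *)

Section TAC.
Variables (C : addcat) (eta : endonat C) (M : C).
Hypothesis C_add_M : forall X : C, in_add M X.
Hypothesis eta_M_regular : regular (eta M : endr M).

Let eta_epi := eta_cancel C_add_M eta_M_regular.

Lemma ebar_exact (U V : C) (d : hom U V) (d' : hom V U) (x : ebar eta M U) :
    d' ∘ d = eta U -> d ∘ d' = eta V ->
    (fmap (ebar_fun eta M) d : {linear _ -> _}) x = 0 ->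
  exists y, (fmap (ebar_fun eta M) d' : {linear _ -> _}) y = x.
Proof.
move=> d'd dd'; have [w ->] := ebarP x.
rewrite ebar_mapE => /(cls_eq0 (etasub eta M V)) [v].
rewrite -ntE -dd' -compA => /eqP; rewrite -subr_eq0 -compBr => /eqP.
move/(factor_mono eta_epi d'd)/eqP; rewrite subr_eq0 => /eqP ->.
by exists (ecls eta v); rewrite ebar_mapE.
Qed.

(** The underlying modules coincide, but the two structures are given by
    different proofs of the module axioms, so the identity is not typed as a
    morphism between them. *)
Lemma ebar_regmod :
  exists f : hom (ebar_fun eta M M) (regmod (gbar eta M)), is_iso f.
Proof.
have fL : linear (fun x : ebar eta M M => x : regmod (gbar eta M)) by [].
have gL : linear (fun x : regmod (gbar eta M) => x : ebar eta M M) by [].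
by exists (mklin fL); exists (mklin gL); apply: lin_eq.
Qed.

(** Linear forms on the reduction of Hom(M, X) come from morphisms X -> M, so
    exactness of the dual is the extension property with target M. *)
Lemma Hom_mod_eta_tac (X : HFact eta) : tac_proj (Hom_mod_eta eta M X).
Proof.
pose P := per (ebar_eta eta M) X.
have PE n : exists W, P n = ebar_fun eta M W :> rmods _ := per_image _ X n.
split; last first.
  move=> n; have -> : Hom_mod_eta eta M X n = P n by [].
  by have [W ->] := PE n; split; [exact: ebar_fin_gen|exact: ebar_projective].
split=> n.
  move=> y; split=> [|[x <-]]; last first.
    by rewrite -[LHS]/((cd P (n + 1) ∘ cd P n : {linear _ -> _}) x) cdd.
  move: y => /=; rewrite !parS negbK; case: (par n) => y /=.
    exact: ebar_exact (d_21 X) (d_12 X).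
  exact: ebar_exact (d_12 X) (d_21 X).
move=> h; split=> [h0|[g <-]]; last by rewrite -compA cdd compm0.
have [k [k' _ kk']] := ebar_regmod.
have [|g gE] := @per_extend _ _ _ (ebar_fun eta M) (ebar_eta eta M)
  (ebar_full C_add_M) (ebar_ker C_add_M) eta_epi X M n (k' ∘ h).
  by rewrite -compA h0 compm0.
exists (k ∘ g); rewrite -compA -gE compA kk'; exact: comp1m.
Qed.

End TAC.

(** * The theorem *)

Lemma fully_faithful_corestrict (C D : preadd) (P : D -> Prop)
    (F : functor C D) (H : forall X, P (F X)) :
  fully_faithful F -> fully_faithful (corestrict H).
Proof. by []. Qed.

Lemma triangle_corestrict (S T : tricat) (P : T -> Prop)
    (PS : forall X, P X -> P (susp X)) (F : functor S T)
    (H : forall X, P (F X)) :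
  triangle_functor F -> @triangle_functor S (fulltri PS) (corestrict H).
Proof. by []. Qed.

Theorem theorem3p5 (C : addcat) (eta : endonat C) (M : C)
  (C_add_M : forall X : C, in_add M X)
  (eta_M_regular : regular (eta M : endr M)) :
  exists H : forall X : HFact eta, tac_proj (Hom_mod_eta eta M X),
    fully_faithful (corestrict H) /\
    @triangle_functor (HFact eta) (Ktac (gbar eta M)) (corestrict H).
Proof.
exists (Hom_mod_eta_tac C_add_M eta_M_regular); split.
  apply: fully_faithful_corestrict; apply: periodic_fully_faithful.
  - exact: ebar_full.
  - exact: ebar_ker.
  - exact: eta_cancel.
by apply: triangle_corestrict; exact: periodic_triangle.
Qed.
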